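(* Let $\{f(x;G):G\in\mathbb{G}\}$ be a nonparametric mixture model, extended to $\overline{\mathbb{G}}$ (proper distributions and subdistributions on $\Theta$), let $G^*\in\mathbb{G}$, and let $x_1,x_2,\ldots$ be i.i.d. observations from $f(x;G^* )$. Assume that (i) the mixture model is identifiable: if $F(x;G)=F(x;G^* )$ for all $x$, then $D_{KW}(G,G^* )=0$; (ii) $\Theta$ is a closed set and, for all $x$ and every $G_0\in\overline{\mathbb{G}}$, $\lim_{G\to G_0}f(x;G)=f(x;G_0)$, the limit being taken over $G\in\overline{\mathbb{G}}$ with $D_{KW}(G,G_0)\to0$. Then the nonparametric MLE $\hat G_n$ satisfies $D_{KW}(\hat G_n,G^* )\to 0$ almost surely as $n\to\infty$.
   Context: $\{f(x;\theta):\theta\in\Theta\}$, $\Theta\subset\mathbb{R}^d$, is a family of probability densities with respect to a $\sigma$-finite measure $\mu$. $\mathbb{G}$ is the space of all probability distributions on $\Theta$ (identified with their c.d.f.s), and $f(x;G)=\int f(x;\theta)\,dG(\theta)$. $\overline{\mathbb{G}}$ is $\mathbb{G}$ supplemented with all subdistributions $\rho G$, $\rho\in[0,1)$, $G\in\mathbb{G}$, with $f(x;\rho G)=\rho\int_\Theta f(x;\theta)\,dG(\theta)$. $F(x;G)=\int_{y\le x}f(y;G)\,d\mu(y)$. The distance is $$D_{KW}(G_1,G_2)=\int_\Theta |G_1(\theta)-G_2(\theta)|\exp(-|\theta|)\,d\theta,$$ with $|\theta|=|\theta_1|+\cdots+|\theta_d|$, extended in the same form to $\overline{\mathbb{G}}$.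 Standing assumption: $D_{KW}$ is a metric on $\overline{\mathbb{G}}$ under which $\overline{\mathbb{G}}$ is compact. The nonparametric MLE $\hat G_n\in\mathbb{G}$ is any (measurable) maximizer of $\ell_n(G)=\sum_{i=1}^n\log f(x_i;G)$: $\ell_n(\hat G_n)=\sup\{\ell_n(G):G\in\mathbb{G}\}$. *)

(* Defs.v *)
From HB Require Import structures.
From mathcomp Require Import all_boot all_order all_algebra.
From mathcomp Require Import all_classical all_reals all_analysis.

Set Implicit Arguments.
Unset Strict Implicit.
Unset Printing Implicit Defensive.

Import Order.TTheory GRing.Theory Num.Theory.
Import numFieldNormedType.Exports.

Local Open Scope classical_set_scope.
Local Open Scope ring_scope.
Local Open Scope ereal_scope.

(* R^n as a measurable space: [n.-tuple] carries the product of the Borel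
   sigma-algebras, that is, the Borel sigma-algebra of R^n. *)
Notation Rn R n := (n.-tuple (measurableTypeR R)).

(* [n.-tuple] has no topology in the library, hence the detour by row
   vectors. *)
Definition closedRn (R : realType) (n : nat) (A : set (Rn R n)) : Prop :=
  closed [set v : 'rV[R]_n | A [tuple v ord0 i | i < n]].

Definition lower_orthant (R : realType) (n : nat) (x : Rn R n) : set (Rn R n) :=
  [set y | forall i : 'I_n, (tnth y i <= tnth x i)%R].

Definition norm1Rn (R : realType) (n : nat) (x : Rn R n) : R :=
  (\sum_(i < n) `|tnth x i|)%R.

(* Lebesgue measure on R^n, obtained from that of R by iterated products. *)
Fixpoint lebesgue_measureRn (R : realType) (n : nat) : set (Rn R n) -> \bar R :=
  match n with
  | 0 => \d_([tuple] : Rn R 0)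
  | m.+1 => pushforward (@lebesgue_measure R \x @lebesgue_measureRn R m)
              (fun z : measurableTypeR R * Rn R m => [tuple of z.1 :: z.2])
  end.

Section mixing_distributions.
Context {R : realType} {d : nat}.
Implicit Types Theta : set (Rn R d).

Record distr Theta := Distr {
  distr_prob :> probability (Rn R d) R ;
  distr_supp : distr_prob Theta = 1 }.

(* The subdistribution rho G is represented by the pair (rho, G); two pairs
   represent the same subdistribution when they have the same c.d.f. *)
Record subdistr Theta := Subdistr {
  sub_mass : R ;
  sub_shape : distr Theta ;
  sub_mass01 : (0 <= sub_mass <= 1)%R }.

Lemma full_mass01 : (0 <= (1 : R) <= 1)%R.
Proof. by rewrite ler01 lexx. Qed.

Definition subdistr_of Theta (G : distr Theta) : subdistr Theta :=
  Subdistr G full_mass01.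

Definition cdfRn Theta (G : subdistr Theta) (t : Rn R d) : \bar R :=
  (sub_mass G)%:E * sub_shape G (lower_orthant t).

Definition D_KW Theta (G1 G2 : subdistr Theta) : \bar R :=
  \int[@lebesgue_measureRn R d]_(t in Theta)
    (`| cdfRn G1 t - cdfRn G2 t | * (expR (- norm1Rn t))%:E).

Definition D_KW_is_metric Theta : Prop :=
  [/\ forall G1 G2 : subdistr Theta, 0 <= D_KW G1 G2 < +oo,
      forall G1 G2 : subdistr Theta,
        D_KW G1 G2 = 0 <-> (forall t, cdfRn G1 t = cdfRn G2 t),
      forall G1 G2 : subdistr Theta, D_KW G1 G2 = D_KW G2 G1 &
      forall G1 G2 G3 : subdistr Theta,
        D_KW G1 G3 <= D_KW G1 G2 + D_KW G2 G3].

Definition D_KW_open Theta (U : set (subdistr Theta)) : Prop :=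
  forall G, U G -> exists2 e : R, (0 < e)%R &
    [set G' | D_KW G' G < e%:E] `<=` U.

Lemma D_KW_openT Theta : D_KW_open [set: subdistr Theta].
Proof. by move=> G _; exists 1%R. Qed.

Lemma D_KW_openI Theta : setI_closed (@D_KW_open Theta).
Proof.
move=> A B oA oB G [/oA[e e0 eA] /oB[e' e'0 e'B]].
exists (Num.min e e'); first by rewrite lt_min e0.
move=> G' /= G'G; split.
  by apply: eA; apply: lt_le_trans G'G _; rewrite lee_fin ge_min lexx.
by apply: e'B; apply: lt_le_trans G'G _; rewrite lee_fin ge_min lexx orbT.
Qed.

Lemma D_KW_open_bigU Theta (I : Type) (U : I -> set (subdistr Theta)) :
  (forall i, D_KW_open (U i)) -> D_KW_open (\bigcup_i U i).
Proof.
move=> oU G [i _ /oU[e e0 eU]]; exists e => // G' /eU UG'; by exists i.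
Qed.

HB.instance Definition _ Theta := gen_eqMixin (subdistr Theta).
HB.instance Definition _ Theta := gen_choiceMixin (subdistr Theta).
HB.instance Definition _ Theta := isOpenTopological.Build (subdistr Theta)
  (@D_KW_openT Theta) (@D_KW_openI Theta) (@D_KW_open_bigU Theta).

End mixing_distributions.

Section mixture_model.
Context {R : realType} {p d : nat}.
Variables (mu : set (Rn R p) -> \bar R) (Theta : set (Rn R d)).
Variable f : Rn R p -> Rn R d -> R.

(* Joint measurability makes f(x;G) a well-defined measurable density. *)
Definition density_family : Prop :=
  [/\ measurable_fun ([set: Rn R p] `*` Theta)
        (fun z : Rn R p * Rn R d => f z.1 z.2),
      forall x theta, Theta theta -> (0 <= f x theta)%R &
      forall theta, Theta theta -> \int[mu]_x (f x theta)%:E = 1].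

Definition mixture (x : Rn R p) (G : subdistr Theta) : \bar R :=
  (sub_mass G)%:E * \int[sub_shape G]_(theta in Theta) (f x theta)%:E.

Definition mixture_cdf (x : Rn R p) (G : subdistr Theta) : \bar R :=
  \int[mu]_(y in lower_orthant x) mixture y G.

Definition loglik (x : nat -> Rn R p) (n : nat) (G : distr Theta) : \bar R :=
  \sum_(i < n) lne (mixture (x i) (subdistr_of G)).

End mixture_model.

Definition mutually_independent (R : realType) (dO dE : measure_display)
    (Omega : measurableType dO) (E : measurableType dE)
    (P : probability Omega R) (X : nat -> Omega -> E) : Prop :=
  forall (s : seq nat) (A : nat -> set E),
    uniq s -> (forall i, measurable (A i)) ->
    P (\bigcap_(i in [set` s]) (X i @^-1` A i)) =
    \big[*%E/1]_(i <- s) P (X i @^-1` A i).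

Definition iid_from (R : realType) (p : nat) (dO : measure_display)
    (Omega : measurableType dO) (P : probability Omega R)
    (mu : set (Rn R p) -> \bar R) (X : nat -> Omega -> Rn R p)
    (g : Rn R p -> \bar R) : Prop :=
  [/\ forall i, measurable_fun [set: Omega] (X i),
      mutually_independent P X &
      forall i (A : set (Rn R p)), measurable A ->
        P (X i @^-1` A) = \int[mu]_(x in A) g x].

(* Measurability is with respect to the Borel sigma-algebra of D_KW. *)
Definition is_NPMLE (R : realType) (p d : nat) (dO : measure_display)
    (Omega : measurableType dO) (Theta : set (Rn R d))
    (f : Rn R p -> Rn R d -> R) (X : nat -> Omega -> Rn R p)
    (n : nat) (Ghat : Omega -> distr Theta) : Prop :=
  (forall U : set (subdistr Theta), open U ->
     measurable [set w | U (subdistr_of (Ghat w))]) /\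
  (forall w, loglik f (X ^~ w) n (Ghat w) =
             ereal_sup [set loglik f (X ^~ w) n G | G in [set: distr Theta]]).

(* Main.v *)
Require Import Defs.
From HB Require Import structures.
From mathcomp Require Import all_boot all_order all_algebra.
From mathcomp Require Import all_classical all_reals all_analysis.
From mathcomp Require Import ring.
Import Order.TTheory GRing.Theory Num.Theory.
Import numFieldNormedType.Exports.
Import measurable_realfun.

Set Implicit Arguments.
Unset Strict Implicit.
Unset Printing Implicit Defensive.

Local Open Scope classical_set_scope.
Local Open Scope ring_scope.
Local Open Scope ereal_scope.

(* Write f* for the true density and h_G = 2 f_G / (f_G + f* ), with values in
   [0, 2]. Comparing the likelihood of the MLE with that of its midpoint with
   G* gives prod_(i < n) h_Ghat(x_i) >= 1, with no logarithm left. On the other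
   hand h_G f* <= (f_G + f* ) / 2 (harmonic versus arithmetic mean), so that
   E h_G <= 1, with equality only if f_G = f* almost everywhere, hence only if
   G = G*. For G <> G*, dominated convergence provides a neighbourhood U of G
   with q = E (sup_U h) < 1. By independence
   P (prod_(i < n) sup_U h(x_i) >= 1) is at most geometric in n, so that by
   Borel-Cantelli the MLE almost surely leaves U for good; countably many such
   U are enough, and compactness concludes. *)

(** * Measurability in R^n: orthants, Lebesgue measure, closed sets *)

Lemma measurable_lower_orthant_graph (R : realType) n :
  measurable [set z : Rn R n * Rn R n | lower_orthant z.1 z.2].
Proof.
have -> : [set z : Rn R n * Rn R n | lower_orthant z.1 z.2] =
    \bigcap_i [set z : Rn R n * Rn R n | (tnth z.2 i <= tnth z.1 i)%R].
  by apply/seteqP; split=> z /= zle i; [move=> _; exact: zle|exact: zle].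
apply: fin_bigcap_measurable => // i _.
have m1 : measurable_fun [set: Rn R n * Rn R n] (fun z => tnth z.1 i).
  exact: (measurableT_comp (measurable_tnth i)).
have m2 : measurable_fun [set: Rn R n * Rn R n] (fun z => tnth z.2 i).
  exact: (measurableT_comp (measurable_tnth i)).
by have := measurable_fun_ler m2 m1 measurableT (Y := [set true]) I; rewrite setTI.
Qed.

Lemma measurable_lower_orthant (R : realType) n (x : Rn R n) :
  measurable (lower_orthant x).
Proof.
have := measurable_xsection x (@measurable_lower_orthant_graph R n).
by rewrite /xsection/=; congr measurable; apply/seteqP; split=> y /=; rewrite inE.
Qed.

Section sigma_finite_measure.
Context dT (T : measurableType dT) (R : realType).
Context (m : {measure set T -> \bar R}) (mfin : sigma_finite setT m).

(* An alias of [m] whose second argument makes [mfin] available to canonical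
   structure inference. *)
Definition sfmeasure of sigma_finite setT m : set T -> \bar R := m.

HB.instance Definition _ := Measure.copy (sfmeasure mfin) m.
HB.instance Definition _ :=
  @Measure_isSigmaFinite.Build _ _ _ (sfmeasure mfin) mfin.

End sigma_finite_measure.

(** This gives the bare set function a measure structure, so that linearity of the integral applies
    to [D_KW]. Sigma-finiteness is carried through the induction because the next product needs
    it. *)
Lemma lebesgue_measureRn_measure (R : realType) n :
  exists m : {sigma_finite_measure set (Rn R n) -> \bar R},
    @lebesgue_measureRn R n = m.
Proof.
elim: n => [|n [m mE]].
  by exists \d_([tuple] : Rn R 0).
pose c (z : measurableTypeR R * Rn R n) : Rn R n.+1 := [tuple of z.1 :: z.2].
have mc : measurable_fun setT c by exact: measurable_cons.
pose c' (t : Rn R n.+1) : measurableTypeR R * Rn R n := (thead t, [tuple of behead t]).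
have cK : cancel c c'.
  by move=> [x t]; rewrite /c' /c/= theadE; congr pair; apply/val_inj.
have mc' : measurable_fun setT c'.
  by apply: measurable_fun_pair; [exact: measurable_tnth|exact: measurable_behead].
have cpre A : c @^-1` (c' @^-1` A) = A.
  by apply/seteqP; split=> z /=; rewrite cK.
pose mm : {measure set (measurableTypeR R * Rn R n)%type -> \bar R} :=
  (@lebesgue_measure R \x m)%E.
(* Both covers are taken nondecreasing, so that the products [F i]*[G i] with a common index already
   cover. *)
have /sigma_finiteP[F [FT ndF Ffin]] := sigma_finiteT (@lebesgue_measure R).
have /sigma_finiteP[G [GT ndG Gfin]] := sigma_finiteT m.
pose M0 : {measure set (Rn R n.+1) -> \bar R} := pushforward mm c.
pose M := M0 mc.
have Mfin : sigma_finite setT M.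
  exists (fun i => c' @^-1` (F i `*` G i)).
    rewrite -preimage_bigcup; apply/esym/seteqP; split => // t _ /=.
    have [i _ Fi] : (\bigcup_i F i) (c' t).1 by rewrite -FT.
    have [j _ Gj] : (\bigcup_i G i) (c' t).2 by rewrite -GT.
    exists (maxn i j) => //; split.
      by move: Fi; apply/subsetPset/ndF/leq_maxl.
    by move: Gj; apply/subsetPset/ndG/leq_maxr.
  move=> i; have [mF Fi] := Ffin i; have [mG Gi] := Gfin i; split.
    by rewrite -[X in measurable X]setTI; apply: mc' => //; exact: measurableX.
  rewrite /M /= /pushforward cpre product_measure1E//.
  by rewrite lte_mul_pinfty// ge0_fin_numE.
by exists (sfmeasure Mfin); rewrite /= mE.
Qed.

(** The complement is open, hence the union of the boxes with rational centre and radius [1 / k.+1]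
    that it contains; there are countably many. *)
Lemma closedRn_measurable (R : realType) n (A : set (Rn R n)) :
  closedRn A -> measurable A.
Proof.
move=> Acl; rewrite -[A]setCK; apply: measurableC.
pose v (t : Rn R n) : 'rV[R]_n := \row_i tnth t i.
have vE (t : Rn R n) : [tuple v t ord0 i | i < n] = t.
  by apply: eq_from_tnth => i; rewrite tnth_mktuple mxE.
have Aop (t : Rn R n) : ~ A t -> exists2 e : R, (0 < e)%R &
    forall s : Rn R n, (forall i, `|tnth t i - tnth s i| < e)%R -> ~ A s.
  move=> At; have := closed_openC Acl; rewrite openE => /(_ (v t)).
  rewrite /setC /= vE => /(_ At) /nbhs_ballP[e /= e0 te].
  exists e => // s st; have := te (v s); rewrite /= vE; apply.
  by split=> // i j; rewrite /ball/= !mxE; exact: st.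
pose box (u : n.-tuple rat * nat) : set (Rn R n) :=
  [set s | forall i, (`|ratr (tnth u.1 i) - tnth s i| < u.2.+1%:R^-1)%R].
have -> : ~` A = \bigcup_(u in setT)
    (if `[< box u `<=` ~` A >] then box u else set0).
  apply/seteqP; split=> [t|t [u _]]; last by case: asboolP => // + ut; exact.
  move=> /Aop[e e0 te].
  (* The box has radius below [e / 2] and its rational centre is within that radius of [t], so all
     its points are within [e] of [t]. *)
  have e20 : (0 < e / 2)%R by rewrite divr_gt0.
  have [k _ /(_ k (leqnn k)) ke] := near_infty_natSinv_lt (PosNum e20).
  have k0 : (0 < k.+1%:R^-1 :> R)%R by rewrite invr_gt0.
  have /choice[q qt] (i : 'I_n) :
      exists q : rat, (`|ratr q - tnth t i| < k.+1%:R^-1)%R.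
    have [|q] := @rat_in_itvoo R (tnth t i - k.+1%:R^-1)%R (tnth t i + k.+1%:R^-1)%R.
      by rewrite ltrD2l gtrN.
    by rewrite in_itv/= -ltr_distl => ?; exists q.
  exists ([tuple q i | i < n], k) => //; case: asboolP.
    by move=> _ i /=; rewrite tnth_mktuple.
  case=> s /= sq; apply: te => i; have := sq i.
  rewrite tnth_mktuple => qs; rewrite (le_lt_trans (ler_distD (ratr (q i)) _ _))//.
  rewrite [ltRHS]splitr ltrD//; last exact: lt_trans ke.
  by rewrite distrC (lt_trans _ ke).
apply: countable_bigcupT_measurable; first by apply: countableP.
move=> u; case: asboolP => // _.
rewrite (_ : box u = \bigcap_i [set s : Rn R n |
    (`|ratr (tnth u.1 i) - tnth s i| < u.2.+1%:R^-1)%R]); last first.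
  by apply/seteqP; split=> s /= us i; [move=> _; exact: us|exact: us].
apply: fin_bigcap_measurable => // i _.
have mi : measurable_fun [set: Rn R n]
    (fun s => `|ratr (tnth u.1 i) - tnth s i|%R).
  apply: (measurableT_comp (@normr_measurable R setT)).
  by apply: measurable_funB => //; exact: measurable_tnth.
have mc : measurable_fun [set: Rn R n] (fun=> u.2.+1%:R^-1 : R)%R by [].
by have := measurable_fun_ltr mi mc measurableT (Y := [set true]) I; rewrite setTI.
Qed.

(** * The metric topology on subdistributions *)

Section D_KW_topology.
Context (R : realType) (d : nat) (Theta : set (Rn R d)).
Context (metric : D_KW_is_metric Theta).
Implicit Types G H : subdistr Theta.

Lemma D_KW_ge0 G H : 0 <= D_KW G H.
Proof. by have [/(_ G H)/andP[]] := metric. Qed.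

Lemma D_KW_ltoo G H : D_KW G H < +oo.
Proof. by have [/(_ G H)/andP[]] := metric. Qed.

Lemma D_KW_fin_num G H : D_KW G H \is a fin_num.
Proof. by rewrite ge0_fin_numE ?D_KW_ge0// D_KW_ltoo. Qed.

Lemma D_KWxx G : D_KW G G = 0.
Proof. by have [_ /(_ G G)[_ + _ _]] := metric; apply. Qed.

Lemma D_KWC G H : D_KW G H = D_KW H G.
Proof. by have [_ _ /(_ G H)] := metric. Qed.

Lemma D_KW_triangle G H K : D_KW G K <= D_KW G H + D_KW H K.
Proof. by have [_ _ _ /(_ G H K)] := metric. Qed.

Lemma D_KW_ball_open G (e : R) : D_KW_open [set H | D_KW H G < e%:E].
Proof.
move=> H /= HG; have /fineK HGE := D_KW_fin_num H G.
exists (e - fine (D_KW H G))%R; first by rewrite subr_gt0 -lte_fin HGE.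
move=> K /= KH; apply: (le_lt_trans (D_KW_triangle K H G)).
by rewrite -HGE -lteBrDr// -EFinB.
Qed.

Lemma D_KW_nbhsP G (A : set (subdistr Theta)) : nbhs G A <->
  exists2 e : R, (0 < e)%R & [set H | D_KW H G < e%:E] `<=` A.
Proof.
split=> [[B [oB BG BA]]|[e e0 eA]].
  by have [e e0 eB] := oB _ BG; exists e => //; exact: subset_trans BA.
exists [set H | D_KW H G < e%:E]; split=> //; first exact: D_KW_ball_open.
by rewrite /= D_KWxx lte_fin.
Qed.

End D_KW_topology.

(** * Distance between two multiples of one distribution *)

Lemma measurable_cdfRn (R : realType) (d : nat) (Theta : set (Rn R d))
  (G : subdistr Theta) : measurable_fun setT (cdfRn G).
Proof.
apply: measurable_funeM.
have := measurable_fun_xsection (sub_shape G) (@measurable_lower_orthant_graph R d).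
congr measurable_fun; apply/funext => t/=; congr (sub_shape G _).
by apply/seteqP; split=> y /=; rewrite /xsection/= inE.
Qed.

Lemma measurable_norm1Rn (R : realType) (n : nat) :
  measurable_fun setT (@norm1Rn R n).
Proof.
apply: measurable_sum => i.
by apply: (measurableT_comp (@normr_measurable R setT)); exact: measurable_tnth.
Qed.

(** The two c.d.f.s are proportional to that of [G]. With [b = 0] this shows how [a G] approaches
    the null subdistribution as [a] decreases to 0. *)
Lemma D_KW_scaled (R : realType) (d : nat) (Theta : set (Rn R d))
    (G : distr Theta) (a b : R) (a01 : (0 <= a <= 1)%R)
    (b01 : (0 <= b <= 1)%R) :
  measurable Theta ->
  D_KW (Subdistr G a01) (Subdistr G b01) =
  `|a - b|%:E * \int[@lebesgue_measureRn R d]_(t in Theta)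
    (G (lower_orthant t) * (expR (- norm1Rn t))%:E).
Proof.
move=> mTheta; rewrite /D_KW.
have [m ->] := lebesgue_measureRn_measure R d.
rewrite -ge0_integralZl_EFin//.
- apply: eq_integral => t _; rewrite muleA; congr (_ * _).
  rewrite /cdfRn/=.
  have /fineK <- := fin_num_measure G _ (measurable_lower_orthant t).
  rewrite -!EFinM -EFinB/= -mulrBl normrM; congr (_ * _)%:E.
  by rewrite ger0_norm// fine_ge0.
- by move=> t _; rewrite mule_ge0// lee_fin expR_ge0.
- apply: emeasurable_funM.
    have := measurable_cdfRn (subdistr_of G); rewrite /cdfRn/=.
    by under eq_fun do rewrite mul1e; exact: measurable_funTS.
  apply/measurable_EFinP; apply: measurable_funTS.
  exact: (measurableT_comp (@measurable_expR R) (measurableT_comp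
    (@oppr_measurable R setT) (@measurable_norm1Rn R d))).
Qed.

(** * The midpoint of two mixing distributions *)

Section midpoint.
Context (R : realType) (d : nat) (Theta : set (Rn R d)).
Implicit Types G H : distr Theta.

Let half : {nonneg R} := 2^-1%:nng%R.

Definition midpoint_measure G H : set (Rn R d) -> \bar R :=
  measure_add (mscale half G) (mscale half H).

HB.instance Definition _ G H := Measure.copy (midpoint_measure G H)
  (measure_add (mscale half G) (mscale half H)).

Lemma midpoint_measureT G H (A : set (Rn R d)) :
  G A = 1 -> H A = 1 -> midpoint_measure G H A = 1.
Proof.
move=> GA HA; rewrite /midpoint_measure measure_addE /mscale/=.
rewrite [X in _ * X + _]GA [X in _ + _ * X]HA !mule1 -EFinD; congr _%:E.
by rewrite [RHS]splitr mul1r.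
Qed.

HB.instance Definition _ G H := Measure_isProbability.Build _ _ _
  (midpoint_measure G H)
  (midpoint_measureT (@probability_setT _ _ _ G) (@probability_setT _ _ _ H)).

Definition midpoint G H : distr Theta :=
  @Distr R d Theta (midpoint_measure G H)
    (midpoint_measureT (distr_supp G) (distr_supp H)).

End midpoint.

(** * Mixture densities: measurability, total mass, finiteness *)

Section mixture_theory.
Context (R : realType) (p d : nat).
Context (mu : {sigma_finite_measure set (Rn R p) -> \bar R}).
Context (Theta : set (Rn R d)) (f : Rn R p -> Rn R d -> R).
Context (dens : density_family mu Theta f).
Context (mTheta : measurable Theta).

(** The family extended by zero outside [Theta]: it is measurable on the whole product space, as
    Tonelli's theorem requires. *)
Let F (z : Rn R p * Rn R d) : \bar R :=
  ((fun z => (f z.1 z.2)%:E) \_ ([set: Rn R p] `*` Theta)) z.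

Let mF : measurable_fun setT F.
Proof.
have [mf _ _] := dens.
apply/(measurable_restrictT _ _).1; first exact: measurableX.
exact/measurable_EFinP.
Qed.

Let F_ge0 z : 0 <= F z.
Proof.
have [_ f0 _] := dens; apply: erestrict_ge0 => -[x t] [_ tT].
by rewrite lee_fin; exact: f0.
Qed.

Let FE x t : F (x, t) = (EFin \o f x) \_ Theta t.
Proof.
rewrite /F !patchE; congr (if _ then _ else _).
by apply/idP/idP => /set_mem => [[_]|]; rewrite in_setE//=.
Qed.

Let mixtureE x (G : subdistr Theta) :
  mixture f x G = (sub_mass G)%:E * \int[sub_shape G]_t F (x, t).
Proof.
by rewrite /mixture integral_mkcond; under [in RHS]eq_integral do rewrite FE.
Qed.

Lemma sub_mass_ge0 (G : subdistr Theta) : (0 <= sub_mass G)%R.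
Proof. by case: G => r G /= /andP[]. Qed.

Lemma mixture_ge0 x (G : subdistr Theta) : 0 <= mixture f x G.
Proof.
rewrite mixtureE mule_ge0// ?lee_fin ?sub_mass_ge0//.
by apply: integral_ge0.
Qed.

Lemma measurable_mixture (G : subdistr Theta) :
  measurable_fun setT (fun x => mixture f x G).
Proof.
under eq_fun do rewrite mixtureE.
by apply: measurable_funeM; exact: measurable_fun_fubini_tonelli_F.
Qed.

Lemma integral_mixture (G : subdistr Theta) :
  \int[mu]_x mixture f x G = (sub_mass G)%:E.
Proof.
have [_ _ f1] := dens.
under eq_integral do rewrite mixtureE.
rewrite ge0_integralZl_EFin ?sub_mass_ge0//; last 2 first.
- by move=> x _; exact: integral_ge0.
- exact: measurable_fun_fubini_tonelli_F.
rewrite (fubini_tonelli F)//= -[RHS]mule1; congr (_ * _).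
(* After Tonelli, 1 is written as the integral of 1 over [Theta], and the two integrands in [t]
   agree pointwise. *)
rewrite -(distr_supp (sub_shape G)) -[RHS]mul1e -integral_cst//.
rewrite [RHS]integral_mkcond; apply: eq_integral => t _.
rewrite patchE; case: ifPn => tT.
  rewrite -(f1 t); last exact: set_mem.
  by apply: eq_integral => x _; rewrite FE patchE tT.
by apply: integral0_eq => x _; rewrite FE patchE (negbTE tT).
Qed.

Lemma mixture_midpoint x (G H : distr Theta) :
  mixture f x (subdistr_of (midpoint G H)) =
  2^-1%:E * (mixture f x (subdistr_of G) + mixture f x (subdistr_of H)).
Proof.
have mFx : measurable_fun setT (fun t => F (x, t)) by exact: measurableT_comp.
rewrite !mixtureE/= !mul1e ge0_integral_measure_add//.
rewrite !ge0_integral_mscale// [RHS]ge0_muleDr//.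
all: exact: integral_ge0.
Qed.

Context (metric : D_KW_is_metric Theta).
Context (f_continuous : forall (x : Rn R p) (G0 : subdistr Theta),
  mixture f x G @[G --> G0] --> mixture f x G0).

(* The masses b G with b > 0 converge to the null subdistribution as b -> 0,
   while f(x; b G) = b f(x; G) would stay infinite if f(x; G) were. *)
Lemma mixture_fin_num x (G : subdistr Theta) : mixture f x G \is a fin_num.
Proof.
case: G => a G a01.
have z01 : (0 <= (0 : R) <= 1)%R by rewrite lexx ler01.
have : nbhs (mixture f x (Subdistr G z01)) [set y : \bar R | y < 1].
  by rewrite /mixture/= mul0e; apply: open_nbhs_nbhs; split;
    [exact: open_ereal_lt_ereal|exact: lte01].
move=> /f_continuous/(D_KW_nbhsP metric)[e e0 /= ball_lt1].
set c := \int[@lebesgue_measureRn R d]_(t in Theta)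
    (G (lower_orthant t) * (expR (- norm1Rn t))%:E).
have cE b (b01 : (0 <= b <= 1)%R) :
    D_KW (Subdistr G b01) (Subdistr G z01) = b%:E * c.
  by rewrite D_KW_scaled// subr0 ger0_norm//; case/andP: b01.
have cfin : c \is a fin_num.
  have o01 : (0 <= (1 : R) <= 1)%R by rewrite lexx ler01.
  by have := D_KW_fin_num metric (Subdistr G o01) (Subdistr G z01); rewrite cE mul1e.
(* Small enough that [b * c < e], which puts [b G] in the ball; the added 1 keeps the denominator
   positive when [c = 0]. *)
pose b : R := Num.min 1%R (e / (1 + `|fine c|))%R.
have b0 : (0 < b)%R by rewrite lt_min ltr01 divr_gt0// ltr_pwDl.
have b01 : (0 <= b <= 1)%R by rewrite ltW//= ge_min lexx.
have : mixture f x (Subdistr G b01) < 1.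
  apply: ball_lt1 => /=; rewrite cE -(fineK cfin) -EFinM lte_fin.
  rewrite (@le_lt_trans _ _ (e / (1 + `|fine c|) * `|fine c|))%R//.
    rewrite (le_trans (ler_wpM2l (ltW b0) (ler_norm _)))// ler_wpM2r//.
    by rewrite ge_min lexx orbT.
  by rewrite mulrAC ltr_pdivrMr ?ltr_pwDl// ltr_pM2l// ltrDr.
rewrite /mixture/=; set I := integral _ _ _ => bI.
have I0 : 0 <= I.
  by have := mixture_ge0 x (subdistr_of G); rewrite /mixture/= mul1e.
have Ifin : I \is a fin_num.
  rewrite ge0_fin_numE//; rewrite ltey; apply/eqP => Ioo.
  by move: bI; rewrite Ioo gt0_muley ?lte_fin.
exact: fin_numM.
Qed.

End mixture_theory.

(** * Products of bounded i.i.d. factors with mean less than one *)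

Lemma measure_bigsetU_le dT (T : measurableType dT) (R : realType)
    (m : {measure set T -> \bar R}) (I : Type) (s : seq I) (A : I -> set T) :
  (forall i, measurable (A i)) ->
  m (\big[setU/set0]_(i <- s) A i) <= \sum_(i <- s) m (A i).
Proof.
move=> mA; elim: s => [|i s IHs]; first by rewrite !big_nil measure0.
rewrite !big_cons (le_trans (measureU2 _ _ _))//.
  exact: bigsetU_measurable.
exact: leeD2l.
Qed.

Lemma geometric_nneseries_lty (R : realType) (s : R) : (0 <= s < 1)%R ->
  \sum_(n <oo) (s ^+ n)%:E < +oo.
Proof.
move=> /andP[s0 s1]; apply: (@le_lt_trans _ _ ((1 - s)^-1)%:E); last exact: ltry.
apply: lime_le.
  by apply: is_cvg_nneseries => n _ _; rewrite lee_fin exprn_ge0.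
apply: nearW => n; rewrite sumEFin lee_fin.
have := congr1 (@^~ n) (geometric_seriesE 1%R (negbT (lt_eqF s1))).
rewrite seriesEnat/=; under eq_bigr do rewrite mul1r; move=> ->.
rewrite mul1r ler_pdivrMr ?subr_gt0// mulVf ?gt_eqF ?subr_gt0//.
by rewrite gerBl exprn_ge0.
Qed.

Section iid_products.
Context (R : realType) (p : nat) (dO : measure_display).
Context (Omega : measurableType dO) (P : probability Omega R).
Context (mu : {measure set (Rn R p) -> \bar R}).
Context (X : nat -> Omega -> Rn R p) (r : Rn R p -> \bar R).
Context (iid : iid_from P mu X r).
Context (mr : measurable_fun setT r).
Context (r0 : forall x, 0 <= r x).

Lemma iid_density1 : \int[mu]_x r x = 1.
Proof.
have [_ _ law] := iid; rewrite -(law 0%N)//.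
exact: probability_setT.
Qed.

Lemma iid_joint n (B : 'I_n -> set (Rn R p)) : (forall i, measurable (B i)) ->
  P (\bigcap_(i in [set: 'I_n]) (X i @^-1` B i)) = \prod_(i < n) \int[mu]_(x in B i) r x.
Proof.
move=> mB; have [_ indep law] := iid.
(* Independence is stated for families indexed by [nat], so the sets are continued by the whole
   space beyond [n]. *)
pose B' (i : nat) := if (insub i : option 'I_n) is Some j then B j else setT.
have B'E (i : 'I_n) : B' i = B i by rewrite /B' valK.
have mB' i : measurable (B' i) by rewrite /B'; case: insubP.
transitivity (P (\bigcap_(i in [set` iota 0 n]) (X i @^-1` B' i))).
  congr (P _); apply/seteqP; split=> w Xw i.
    rewrite /= mem_iota add0n => /= ltin.
    by rewrite -[i]/(val (Ordinal ltin)) B'E; exact: Xw.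
  by move=> _; rewrite /= -B'E; apply: Xw; rewrite /= mem_iota ltn_ord.
rewrite indep ?iota_uniq//.
rewrite -{1}(subn0 n) -/(index_iota 0 n) big_mkord; apply: eq_bigr => i _.
by rewrite B'E law.
Qed.

Context (h : Rn R p -> R) (M : nat).
Context (mh : measurable_fun setT h).
Context (h01 : forall x, (0 <= h x < M%:R)%R).
Context (hr1 : \int[mu]_x ((h x)%:E * r x) < 1).

(* [h] is replaced by a step function with values in multiples of 1 / N.+1 that
   exceeds it by at most 1 / N.+1; the event then splits according to the
   sequence of levels, and independence is only needed for events. *)
Lemma iid_prod_lt1 :
  {ae P, forall w, \forall n \near \oo, (\prod_(i < n) h (X i w) < 1)%R}.
Proof.
have [mX _ _] := iid.
have hr0 : 0 <= \int[mu]_x ((h x)%:E * r x).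
  by apply: integral_ge0 => x _; rewrite mule_ge0// lee_fin; case/andP: (h01 x).
have hrfin : \int[mu]_x ((h x)%:E * r x) \is a fin_num.
  by rewrite ge0_fin_numE// (lt_trans hr1)// ltry.
pose c := fine (\int[mu]_x ((h x)%:E * r x)).
have c1 : (0 < 1 - c)%R by rewrite subr_gt0 -lte_fin fineK.
(* The mesh [1 / N.+1] is finer than the gap [1 - c], so that rounding up keeps the mean below 1. *)
have [N _ /(_ N (leqnn N)) Nc] := near_infty_natSinv_lt (PosNum c1).
rewrite /= in Nc.
(* Since [h < M], this many levels of width [1 / N.+1] suffice; on [B k] the step function takes the
   right endpoint [a k]. *)
pose K := (M * N.+1)%N.
pose a (k : 'I_K) : R := (k.+1%:R / N.+1%:R)%R.
pose B (k : 'I_K) := [set x | (k%:R / N.+1%:R <= h x < a k)%R].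
have mB k : measurable (B k).
  have -> : B k = h @^-1` `[(k%:R / N.+1%:R)%R, a k[%classic.
    by apply/seteqP; split=> x; rewrite /= in_itv.
  by rewrite -[X in measurable X]setTI; exact: mh.
have hB x : exists k, B k x.
  have /andP[hx0 hxM] := h01 x.
  have /Num.Theory.truncn_itv/andP[lehx lthx] : (0 <= h x * N.+1%:R)%R.
    by rewrite mulr_ge0.
  have ltK : (Num.truncn (h x * N.+1%:R) < K)%N.
    by rewrite -(ltr_nat R) (le_lt_trans lehx)// natrM ltr_pM2r.
  exists (Ordinal ltK); rewrite /B /a /=.
  by rewrite ler_pdivrMr// ltr_pdivlMr// lehx.
have BU : \big[setU/set0]_(k <- index_enum 'I_K) B k = setT.
  rewrite -bigcup_seq; apply/seteqP; split=> // x _.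
  by have [k Bkx] := hB x; exists k => //=; exact: mem_index_enum.
have trivB : trivIset [set` index_enum 'I_K] B.
  have ltBB (j k : 'I_K) x : B j x -> B k x -> (j <= k)%N.
    move=> /andP[jx _] /andP[_ /(le_lt_trans jx)].
    by rewrite ltr_pM2r ?invr_gt0// ltr_nat.
  move=> j k _ _ [x [Bj Bk]]; apply/val_inj/eqP.
  by rewrite eqn_leq (ltBB _ _ x)// (ltBB _ _ x).
pose q k := \int[mu]_(x in B k) r x.
have q0 k : 0 <= q k by apply: integral_ge0.
have q1 k : q k \is a fin_num.
  rewrite ge0_fin_numE// (@le_lt_trans _ _ 1) ?ltry// -iid_density1.
  exact: ge0_subset_integral.
(* The mean of the step function, at most [c + 1 / N.+1] and hence below 1. *)
pose s := (\sum_k a k * fine (q k))%R.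
have a0 k : (0 <= a k)%R by rewrite divr_ge0.
have s0 : (0 <= s)%R by apply: sumr_ge0 => k _; rewrite mulr_ge0// fine_ge0.
have s1 : (s < 1)%R.
  have mhr : measurable_fun setT (fun x => (h x)%:E * r x).
    by apply: emeasurable_funM => //; exact/measurable_EFinP.
  have mhNr : measurable_fun setT (fun x => (h x + N.+1%:R^-1)%:E * r x).
    apply: emeasurable_funM => //; apply/measurable_EFinP.
    exact: measurable_funD.
  have hN0 x : 0 <= (h x + N.+1%:R^-1)%:E * r x.
    by rewrite mule_ge0// lee_fin addr_ge0//; case/andP: (h01 x).
  rewrite -lte_fin (@le_lt_trans _ _ (\int[mu]_x ((h x + N.+1%:R^-1)%:E * r x)))//.
    rewrite -BU ge0_integral_bigsetU//; last 2 first.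
    - by rewrite /index_enum -enumT enum_uniq.
    - by rewrite BU.
    rewrite /s -sumEFin; apply: lee_sum => k _.
    rewrite EFinM fineK// /q -ge0_integralZl_EFin//; last exact: measurable_funTS.
    apply: ge0_le_integral => //.
    - by move=> x _; rewrite mule_ge0// lee_fin.
    - by apply: measurable_funeM; exact: measurable_funTS.
    - exact: measurable_funTS.
    - move=> x /andP[kx _]; rewrite lee_wpmul2r// lee_fin /a -natr1 mulrDl mul1r.
      by rewrite lerD2r.
  rewrite (eq_integral (fun x => (h x)%:E * r x + (N.+1%:R^-1)%:E * r x)); last first.
    by move=> x _; rewrite EFinD ge0_muleDl ?lee_fin//; case/andP: (h01 x).
  rewrite ge0_integralD//.
  - rewrite ge0_integralZl_EFin// iid_density1 mule1 -(fineK hrfin) -/c.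
    by rewrite -EFinD lte_fin addrC -ltrBrDr.
  - by move=> x _; rewrite mule_ge0// lee_fin; case/andP: (h01 x).
  - by move=> x _; rewrite mule_ge0.
  - exact: measurable_funeM.
pose A n := [set w | (1 <= \prod_(i < n) h (X i w))%R].
have mA n : measurable (A n).
  have mp : measurable_fun setT (fun w => \prod_(i < n) h (X i w))%R.
    by apply: measurable_prod => i _; exact: (measurableT_comp mh).
  have m1 : measurable_fun [set: Omega] (fun=> 1 : R)%R by [].
  by have := measurable_fun_ler m1 mp measurableT (Y := [set true]) I; rewrite setTI.
have PA n : P (A n) <= (s ^+ n)%:E.
  pose C (k : {ffun 'I_n -> 'I_K}) := \bigcap_(i in [set: 'I_n]) (X i @^-1` B (k i)).
  (* Only these sequences of levels can occur on [A n], because the right endpoints dominate [h]. *)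
  pose D := [seq k : {ffun 'I_n -> 'I_K} <- index_enum {ffun 'I_n -> 'I_K} |
    (1 <= \prod_i a (k i))%R].
  have mC k : measurable (C k).
    apply: fin_bigcap_measurable => // i _.
    by rewrite -[X in measurable X]setTI; exact: mX.
  have AC : A n `<=` \big[setU/set0]_(k <- D) C k.
    move=> w /= Aw; rewrite -bigcup_seq.
    have /choice[k kB] (i : 'I_n) := hB (X i w).
    exists [ffun i => k i]; last by move=> i _ /=; rewrite ffunE.
    rewrite /= mem_filter mem_index_enum andbT (le_trans Aw)//.
    apply: ler_prod => i _; rewrite ffunE; have /andP[_ /ltW ->] := kB i.
    by rewrite andbT; case/andP: (h01 (X i w)).
  apply: (@le_trans _ _ (P (\big[setU/set0]_(k <- D) C k))).
    by apply: le_measure => //; rewrite inE//; apply: bigsetU_measurable.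
  apply: (le_trans (measure_bigsetU_le _ _ mC)).
  have PC k : P (C k) = (\prod_(i < n) fine (q (k i)))%:E.
    rewrite iid_joint// -prodEFin; apply: eq_bigr => i _.
    by rewrite fineK.
  rewrite (eq_bigr _ (fun k _ => PC k)).
  rewrite sumEFin lee_fin big_filter.
  (* Markov's inequality in discrete form: [s ^+ n] expands over all sequences of levels; those
     outside [D] are dropped, and on [D] the factor [\prod_i a (k i)] is at least 1. *)
  have -> : (s ^+ n =
      \sum_(k : {ffun 'I_n -> 'I_K}) \prod_i (a (k i) * fine (q (k i))))%R.
    by rewrite -(bigA_distr_bigA (fun _ k => a k * fine (q k))%R) prodr_const card_ord.
  rewrite [leRHS](bigID (fun k : {ffun 'I_n -> 'I_K} => (1 <= \prod_i a (k i))%R))/=.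
  rewrite -[leLHS]addr0 lerD//; last first.
    by apply: sumr_ge0 => k _; apply: prodr_ge0 => i _; rewrite mulr_ge0// fine_ge0.
  apply: ler_sum => k ak; rewrite big_split/= ler_peMl//.
  by apply: prodr_ge0 => i _; rewrite fine_ge0.
(* Borel-Cantelli: the exceptional set consists of the [w] lying in infinitely many [A n]. *)
exists (lim_sup_set A); split.
- apply: bigcap_measurable => // n _; exact: bigcup_measurable.
- apply: lim_sup_set_cvg0 => //.
  apply: (@le_lt_trans _ _ (\sum_(n <oo) (s ^+ n)%:E)).
    by apply: lee_nneseries => [n _ _|n _]; [exact: measure_ge0|exact: PA].
  by apply: geometric_nneseries_lty; rewrite s0.
- move=> w /= wN n _; apply: contrapT => wn; apply: wN.
  exists n => // m /= nm; rewrite ltNge; apply/negP => Am; apply: wn.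
  by exists m.
Qed.

End iid_products.

(** * Total boundedness and separability for [D_KW] *)

Section dense_sequence.
Context (R : realType) (d : nat) (Theta : set (Rn R d)).
Context (metric : D_KW_is_metric Theta).
Context (cpt : compact [set: subdistr Theta]).

Lemma D_KW_totally_bounded (e : R) : (0 < e)%R ->
  exists s : seq (subdistr Theta), forall G, exists2 H, H \in s & D_KW H G < e%:E.
Proof.
move=> e0; move/compact_near_coveringP : cpt.
(* Compactness is used as near-covering along the filter of finite families directed by inclusion;
   locally at [G] it is enough that the family contain [G]. *)
pose F := filter_from setT (fun s0 : seq (subdistr Theta) =>
  [set s : seq (subdistr Theta) | {subset s0 <= s}]).
have FF : Filter F.
  apply: filter_fromT_filter; first by exists [::].
  move=> s1 s2; exists (s1 ++ s2) => s /= ss.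
  by split=> G Gs; apply: ss; rewrite mem_cat Gs ?orbT.
move=> /(_ _ F (fun s G => exists2 H, H \in s & D_KW H G < e%:E) FF)[].
  move=> G _; exists ([set H | D_KW H G < e%:E],
    [set s : seq (subdistr Theta) | {subset [:: G] <= s}]).
    split=> /=; last by exists [:: G].
    by apply/(D_KW_nbhsP metric); exists e.
  move=> [H s] [/= HG Gs]; exists G; first by apply: Gs; rewrite mem_head.
  by rewrite (D_KWC metric).
by move=> s0 _ /(_ s0) s0P; exists s0 => G; exact: s0P.
Qed.

(** Finite nets of radius [1 / m.+1], for all [m], are listed in one sequence through an encoding of
    pairs; [G0] is the default past the end of a net. *)
Lemma D_KW_separable (G0 : subdistr Theta) : exists D : nat -> subdistr Theta,
  forall G (e : R), (0 < e)%R -> exists k, D_KW (D k) G < e%:E.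
Proof.
have /choice[s sP] (m : nat) : exists s : seq (subdistr Theta),
    forall G, exists2 H, H \in s & D_KW H G < (m.+1%:R^-1)%:E.
  exact: D_KW_totally_bounded.
exists (fun n => let: (m, j) := odflt (0, 0)%N (unpickle n) in nth G0 (s m) j).
move=> G e e0; have [m _ /(_ m (leqnn m)) me] := near_infty_natSinv_lt (PosNum e0).
have [H Hs HG] := sP m G; exists (pickle (m, index H (s m))).
by rewrite pickleK/= nth_index// (lt_trans HG)// lte_fin.
Qed.

End dense_sequence.

(** * The likelihood ratio: continuity, mean, local domination *)

Lemma cvg_ratio (R : realType) (T : Type) (F : set_system T) {FF : Filter F}
    (u : T -> R) (l c : R) : (0 < l + c)%R -> u t @[t --> F] --> l ->
  (2 * u t / (u t + c))%R @[t --> F] --> (2 * l / (l + c))%R.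
Proof.
move=> lc0 ul; apply: cvgM; first by apply: cvgM => //; exact: cvg_cst.
apply: cvgV; first by rewrite gt_eqF.
by apply: cvgD => //; exact: cvg_cst.
Qed.

Section likelihood_ratio.
Context (R : realType) (p d : nat).
Context (mu : {sigma_finite_measure set (Rn R p) -> \bar R}).
Context (Theta : set (Rn R d)) (f : Rn R p -> Rn R d -> R).
Context (dens : density_family mu Theta f).
Context (mTheta : measurable Theta).
Context (metric : D_KW_is_metric Theta).
Context (cpt : compact [set: subdistr Theta]).
Context (f_continuous : forall (x : Rn R p) (G0 : subdistr Theta),
  mixture f x G @[G --> G0] --> mixture f x G0).
Context (Gstar : distr Theta).
Context (identifiable : forall G : distr Theta,
  (forall x, mixture_cdf mu f x (subdistr_of G) =
             mixture_cdf mu f x (subdistr_of Gstar)) ->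
  D_KW (subdistr_of G) (subdistr_of Gstar) = 0).

Let fin := mixture_fin_num dens mTheta metric f_continuous.

Let a (G : subdistr Theta) x : R := fine (mixture f x G).
Let b x : R := a (subdistr_of Gstar) x.

(* At points where both densities vanish this is 0 / 0 = 0. *)
Definition lratio (G : subdistr Theta) (x : Rn R p) : R := (2 * a G x / (a G x + b x))%R.

Let aE G x : (a G x)%:E = mixture f x G. Proof. by rewrite fineK. Qed.

Let bE x : (b x)%:E = mixture f x (subdistr_of Gstar). Proof. exact: aE. Qed.

Let a0 G x : (0 <= a G x)%R. Proof. by rewrite fine_ge0// (mixture_ge0 dens). Qed.

Let b0 x : (0 <= b x)%R. Proof. exact: a0. Qed.

Let ma G : measurable_fun setT (a G).
Proof.
apply/measurable_EFinP.
rewrite (_ : EFin \o a G = fun x => mixture f x G); last first.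
  by apply/funext => x; exact: aE.
exact: measurable_mixture dens mTheta G.
Qed.

Lemma lratio_ge0 G x : (0 <= lratio G x)%R.
Proof. by rewrite /lratio divr_ge0 ?mulr_ge0 ?addr_ge0. Qed.

Lemma lratio_le2 G x : (lratio G x <= 2)%R.
Proof.
rewrite /lratio; have [->|ab] := eqVneq (a G x + b x)%R 0%R.
  by rewrite invr0 mulr0.
have ab0 : (0 < a G x + b x)%R by rewrite lt_neqAle eq_sym ab addr_ge0.
by rewrite ler_pdivrMr// ler_pM2l// lerDl.
Qed.

Lemma measurable_lratio G : measurable_fun setT (lratio G).
Proof.
(* The real power of exponent -1 is measurable and agrees with the inverse at every nonnegative
   argument, zero included. *)
have -> : lratio G = fun x => (2 * a G x * powR (a G x + b x) (-1))%R.
  by apply/funext => x; rewrite powR_inv1// addr_ge0.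
apply: measurable_funM; first exact: measurable_funM.
apply: (measurableT_comp (f := fun t : R => powR t (-1))) => //.
by apply: measurable_funD; exact: ma.
Qed.

(** A positive true density keeps the denominator away from zero, even where the density of [G0]
    vanishes. *)
Lemma lratio_continuous G0 x : 0 < mixture f x (subdistr_of Gstar) ->
  lratio G x @[G --> G0] --> lratio G0 x.
Proof.
rewrite -aE lte_fin -/(b x) => bx0.
have ac : a G x @[G --> G0] --> a G0 x.
  apply: (@fine_cvg _ (subdistr Theta) (nbhs G0)); rewrite fineK//; exact: f_continuous.
apply: (@cvg_ratio _ _ (nbhs G0) (nbhs_filter G0)) => //.
by rewrite ltr_wpDl.
Qed.

Lemma integral_lratio_lt1 G0 : D_KW G0 (subdistr_of Gstar) != 0 ->
  \int[mu]_x ((lratio G0 x)%:E * mixture f x (subdistr_of Gstar)) < 1.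
Proof.
move=> G0star.
rewrite (eq_integral (fun x => (lratio G0 x * b x)%:E)); last first.
  by move=> x _; rewrite -bE -EFinM.
rewrite ltNge; apply/negP => le1.
pose phi x : R := ((a G0 x + b x) / 2 - lratio G0 x * b x)%R.
have mlb : measurable_fun setT (fun x => lratio G0 x * b x)%R.
  by apply: measurable_funM; [exact: measurable_lratio|exact: ma].
have mab : measurable_fun setT (fun x => (a G0 x + b x) / 2)%R.
  by apply: measurable_funM => //; apply: measurable_funD; exact: ma.
have mphi : measurable_fun setT phi by exact: measurable_funB.
(* the gap between the arithmetic and the harmonic mean of [a] and [b] *)
have phiE x : (phi x = (a G0 x - b x) ^+ 2 / (2 * (a G0 x + b x)))%R.
  rewrite /phi /lratio; have [ab|ab] := eqVneq (a G0 x + b x)%R 0%R.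
    by rewrite ab !(mulr0, invr0, mul0r) subrr.
  by field; rewrite ab.
have phi0 x : (0 <= phi x)%R.
  by rewrite phiE divr_ge0 ?sqr_ge0// mulr_ge0 ?addr_ge0.
have phi_eq0 x : phi x = 0%R -> a G0 x = b x.
  have [/eqP|ab] := eqVneq (a G0 x + b x)%R 0%R.
    by rewrite paddr_eq0// => /andP[/eqP -> /eqP ->].
  rewrite phiE => /eqP; rewrite mulf_eq0 sqrf_eq0 subr_eq0 invr_eq0.
  by rewrite [X in _ || X]mulf_eq0 (negbTE ab) orbF pnatr_eq0 orbF => /eqP.
have Eab : \int[mu]_x ((a G0 x + b x) / 2)%:E = ((sub_mass G0 + 1) / 2)%:E.
  rewrite (eq_integral (fun x => 2^-1%:E *
      (mixture f x G0 + mixture f x (subdistr_of Gstar)))); last first.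
    by move=> x _; rewrite -bE -aE -EFinD -EFinM mulrC.
  rewrite ge0_integralZl_EFin//; last 2 first.
  - by move=> x _; rewrite adde_ge0 ?(mixture_ge0 dens).
  - by apply: emeasurable_funD; exact: measurable_mixture dens mTheta _.
  rewrite ge0_integralD//; [|by move=> x _; exact: (mixture_ge0 dens)|
    exact: measurable_mixture dens mTheta _|
    by move=> x _; exact: (mixture_ge0 dens)|
    exact: measurable_mixture dens mTheta _].
  by rewrite !(integral_mixture dens mTheta) -EFinD -EFinM mulrC.
have Esum : \int[mu]_x ((a G0 x + b x) / 2)%:E =
    \int[mu]_x (phi x)%:E + \int[mu]_x (lratio G0 x * b x)%:E.
  rewrite -ge0_integralD//.
  - by apply: eq_integral => x _; rewrite -EFinD subrK.
  - by move=> x _; rewrite lee_fin.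
  - exact/measurable_EFinP.
  - by move=> x _; rewrite lee_fin mulr_ge0 ?lratio_ge0.
  - exact/measurable_EFinP.
have Iphi0 : 0 <= \int[mu]_x (phi x)%:E by apply: integral_ge0 => x _; rewrite lee_fin.
have mass1 : (sub_mass G0 <= 1)%R by case: (G0) => ? ? /= /andP[].
(* The arithmetic mean integrates to [(sub_mass G0 + 1) / 2 <= 1] and the harmonic one to at least 1
   by [le1], which leaves nothing for their nonnegative gap. *)
have Iphi : \int[mu]_x (phi x)%:E = 0.
  apply/eqP; rewrite eq_le Iphi0 andbT -(@leeD2rE _ 1)// add0e.
  rewrite (@le_trans _ _ ((sub_mass G0 + 1) / 2)%:E)//.
    by rewrite -Eab Esum leeD2l.
  by rewrite lee_fin ler_pdivrMr// mul1r -[leRHS]/(1 + 1)%R lerD2r.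
have /ae_eq_integral_abs : \int[mu]_x `|(phi x)%:E| = 0.
  by rewrite -{}Iphi; apply: eq_integral => x _; rewrite gee0_abs// lee_fin.
move=> /(_ measurableT ((measurable_EFinP _ _).2 mphi)) ae_phi.
have mixae : ae_eq mu setT (fun x => mixture f x G0)
    (fun x => mixture f x (subdistr_of Gstar)).
  apply: filterS ae_phi => x /(_ I) [/phi_eq0 abx] _.
  by rewrite -bE -aE abx.
have mixcdf A : measurable A ->
    \int[mu]_(x in A) mixture f x G0 = \int[mu]_(x in A) mixture f x (subdistr_of Gstar).
  move=> mA; apply: ae_eq_integral => //.
  - by apply: measurable_funTS; exact: measurable_mixture dens mTheta _.
  - by apply: measurable_funTS; exact: measurable_mixture dens mTheta _.
  - by apply: filterS mixae => x /(_ I).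
(* Integrating the two equal densities over the whole space gives [G0] mass 1, so that it is a
   proper distribution and identifiability applies to it. *)
move: mixcdf G0star; have := integral_mixture dens mTheta G0.
case: (G0) => m G m01 + mixcdf; rewrite mixcdf// (integral_mixture dens mTheta)/=.
move=> [m1]; move: m01 mixcdf; rewrite -{}m1 => m01 mixcdf /eqP; apply.
by apply: identifiable => x; apply: mixcdf; exact: measurable_lower_orthant.
Qed.

(* [h] is a supremum over those elements of a dense sequence that lie close to
   [G0], which keeps it measurable; by continuity it bounds a whole ball. *)
Lemma lratio_dominated G0 : D_KW G0 (subdistr_of Gstar) != 0 ->
  exists e : R, exists h : Rn R p -> R, [/\ (0 < e)%R,
    measurable_fun setT h, forall x, (0 <= h x <= 2)%R,
    \int[mu]_x ((h x)%:E * mixture f x (subdistr_of Gstar)) < 1 &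
    forall G x, D_KW G G0 < e%:E -> 0 < mixture f x (subdistr_of Gstar) ->
      (lratio G x <= h x)%R].
Proof.
move=> G0star; have [D Ddense] := D_KW_separable metric cpt G0.
(* Elements outside the ball contribute 0, which does not affect an upper bound of nonnegative
   ratios. *)
pose u m k x : R :=
  if D_KW (D k) G0 < (m.+1%:R^-1)%:E then lratio (D k) x else 0%R.
have u02 m k x : (0 <= u m k x <= 2)%R.
  rewrite /u; case: ifP => _; last by rewrite lexx ler0n.
  by rewrite lratio_ge0 lratio_le2.
pose g m x : R := sups (fun k => u m k x) 0%N.
have ubu m x : has_ubound (range (fun k => u m k x)).
  by exists 2%R => _ [k _ <-]; case/andP: (u02 m k x).
have u_le_g m k x : (u m k x <= g m x)%R.
  apply: ub_le_sup; last by exists k.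
  by apply: has_ubound_sdrop; exact: ubu.
have g_le m x y : (forall k, u m k x <= y)%R -> (g m x <= y)%R.
  move=> uy; apply: ge_sup; first by exists (u m 0%N x); exists 0%N.
  by move=> _ [k _ <-].
have g02 m x : (0 <= g m x <= 2)%R.
  rewrite (le_trans _ (u_le_g m 0%N x)) ?g_le//.
    by move=> k; case/andP: (u02 m k x).
  by case/andP: (u02 m 0%N x).
have mg m : measurable_fun setT (g m).
  apply: measurable_fun_sups => [x _|k]; first exact: ubu.
  by rewrite /u; case: (_ < _) => //; exact: measurable_lratio.
have lratio_near G x (e : R) : 0 < mixture f x (subdistr_of Gstar) -> (0 < e)%R ->
    exists2 r : R, (0 < r)%R &
      forall H, D_KW H G < r%:E -> (`|lratio G x - lratio H x| < e)%R.
  move=> rx e0; have /cvgrPdist_lt/(_ e e0) := lratio_continuous (G0 := G) rx.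
  by move=> /(D_KW_nbhsP metric)[r r0 rP]; exists r.
have lratio_le_g m G x : D_KW G G0 < (m.+1%:R^-1)%:E ->
    0 < mixture f x (subdistr_of Gstar) -> (lratio G x <= g m x)%R.
  move=> GG0 rx; apply/ler_addgt0Pr => e e0.
  have [r r0 rP] := lratio_near G x e rx e0.
  have [r' r'0 r'P] := D_KW_ball_open metric GG0.
  (* Within [r] of [G] the ratio changes by less than [e]; within [r'] one stays in the ball around
     [G0], so that [D k] counts in the supremum. *)
  have [|k Dk] := Ddense G (Num.min r r'); first by rewrite lt_min r0.
  have DkG0 : D_KW (D k) G0 < (m.+1%:R^-1)%:E.
    by apply: r'P; rewrite /= (lt_le_trans Dk)// lee_fin ge_min lexx orbT.
  have /ltr_distlDr/ltW/le_trans -> // : (`|lratio G x - lratio (D k) x| < e)%R.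
    by apply: rP; rewrite (lt_le_trans Dk)// lee_fin ge_min lexx.
  by rewrite lerD2r (le_trans _ (u_le_g m k x))// /u DkG0.
(* [G0] lies in every ball, whence the lower bound; continuity at [G0] bounds the supremum from
   above once the radius is small. *)
have g_cvg x : 0 < mixture f x (subdistr_of Gstar) ->
    g m x @[m --> \oo] --> lratio G0 x.
  move=> rx; apply/cvgrPdist_le => e e0.
  have [r r0 rP] := lratio_near G0 x e rx e0.
  have := near_infty_natSinv_lt (PosNum r0); apply: filterS => m /= mr.
  rewrite ler_distlC; apply/andP; split.
    rewrite (@le_trans _ _ (lratio G0 x))//; first by rewrite gerBl ltW.
    by apply: lratio_le_g => //; rewrite (D_KWxx metric) lte_fin.
  apply: g_le => k; rewrite /u; case: ifPn => [DkG0|_]; last first.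
    by rewrite addr_ge0 ?lratio_ge0// ltW.
  have : (`|lratio G0 x - lratio (D k) x| < e)%R.
    by apply: rP; rewrite (lt_trans DkG0)// lte_fin.
  by rewrite ltr_distlC => /andP[_ /ltW].
have m_r := measurable_mixture dens mTheta (subdistr_of Gstar).
have r_ge0 x : 0 <= mixture f x (subdistr_of Gstar) by exact: (mixture_ge0 dens).
have mgr m : measurable_fun setT (fun x => (g m x)%:E * mixture f x (subdistr_of Gstar)).
  by apply: emeasurable_funM => //; exact/measurable_EFinP.
have [|||||_ _ cvgI] := @dominated_convergence _ _ _ mu setT measurableT
  (fun m x => (g m x)%:E * mixture f x (subdistr_of Gstar))
  (fun x => (lratio G0 x)%:E * mixture f x (subdistr_of Gstar))
  (fun x => 2%:E * mixture f x (subdistr_of Gstar)).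
- exact: mgr.
- by apply: emeasurable_funM => //; apply/measurable_EFinP; exact: measurable_lratio.
- apply: aeW => x _; rewrite -bE.
  under eq_fun do rewrite -EFinM.
  rewrite -EFinM; apply: cvg_EFin; first exact: nearW.
  (* Where the true density vanishes, [g m x] need not converge, but its product with that density
     is 0. *)
  have [bx0|bx0] := eqVneq (b x) 0%R.
    by rewrite bx0 mulr0; under eq_fun do rewrite mulr0; exact: cvg_cst.
  apply: cvgM; last exact: cvg_cst.
  by apply: g_cvg; rewrite -bE lte_fin lt_neqAle eq_sym bx0 b0.
- apply/integrableP; split; first exact: measurable_funeM.
  rewrite (eq_integral (fun x => 2%:E * mixture f x (subdistr_of Gstar))); last first.
    by move=> x _; rewrite gee0_abs// mule_ge0.
  rewrite ge0_integralZl_EFin// (integral_mixture dens mTheta)/= -EFinM.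
  exact: ltry.
- apply: aeW => x m _; rewrite gee0_abs.
    by rewrite lee_wpmul2r// lee_fin; case/andP: (g02 m x).
  by rewrite mule_ge0// lee_fin; case/andP: (g02 m x).
(* The integrals tend to a limit below 1, so one of them is already below 1; its index gives the
   radius. *)
have [|m _ /(_ m (leqnn m)) /= gm1] := cvgI [set y | y < 1].
  by apply: open_nbhs_nbhs; split;
    [exact: open_ereal_lt_ereal|exact: integral_lratio_lt1].
exists (m.+1%:R^-1)%R, (g m); split => // G x GG0 rx; exact: lratio_le_g.
Qed.

End likelihood_ratio.

(** * The likelihood ratio at a maximizer *)

Section mle_ratio.
Context (R : realType) (p d : nat).
Context (mu : {sigma_finite_measure set (Rn R p) -> \bar R}).
Context (Theta : set (Rn R d)) (f : Rn R p -> Rn R d -> R).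
Context (dens : density_family mu Theta f).
Context (mTheta : measurable Theta).
Context (mixture_fin : forall x (G : subdistr Theta), mixture f x G \is a fin_num).

(** The ratio [lratio] is the density of [G] divided by that of the midpoint of [G] and [Gstar], so
    the product is a quotient of two likelihoods. *)
Lemma mle_lratio_ge1 (Gstar G : distr Theta) (x : nat -> Rn R p) n :
  (forall i, 0 < mixture f (x i) (subdistr_of Gstar)) ->
  (forall H : distr Theta, loglik f x n H <= loglik f x n G) ->
  (1 <= \prod_(i < n) lratio f Gstar (subdistr_of G) (x i))%R.
Proof.
move=> star_gt0 /(_ (midpoint G Gstar)); rewrite /loglik.
pose a i : R := fine (mixture f (x i) (subdistr_of G)).
pose b i : R := fine (mixture f (x i) (subdistr_of Gstar)).
pose m i : R := ((a i + b i) / 2)%R.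
have aE i : mixture f (x i) (subdistr_of G) = (a i)%:E by rewrite fineK.
have bE i : mixture f (x i) (subdistr_of Gstar) = (b i)%:E by rewrite fineK.
have a0 i : (0 <= a i)%R by rewrite fine_ge0// (mixture_ge0 dens).
have b0 i : (0 < b i)%R by rewrite -lte_fin -bE.
have m0 i : (0 < m i)%R by rewrite divr_gt0// ltr_wpDl.
have mE i : mixture f (x i) (subdistr_of (midpoint G Gstar)) = (m i)%:E.
  by rewrite (mixture_midpoint dens mTheta) aE bE -EFinD -EFinM mulrC.
under eq_bigr do rewrite mE lne_EFin//.
under [leRHS]eq_bigr do rewrite aE.
rewrite sumEFin => le_ma.
(* A single zero would make the log-likelihood of [G] equal to [-oo], below the finite one of the
   midpoint. *)
have a_gt0 (i : 'I_n) : (0 < a i)%R.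
  rewrite lt_neqAle a0 andbT; apply/eqP => ai0.
  have : \sum_(j < n) lne (a j)%:E = -oo.
    by apply/esum_eqNyP; exists i; rewrite mem_index_enum -ai0 le0_lneNy.
  by move=> sumNy; move: le_ma; rewrite sumNy leeNy_eq.
move: le_ma; under [leRHS]eq_bigr do rewrite lne_EFin//.
rewrite sumEFin lee_fin -ler_expR !expR_sum.
rewrite (eq_bigr (fun i : 'I_n => m i)); last by move=> i _; rewrite lnK// posrE.
rewrite [leRHS](eq_bigr (fun i : 'I_n => a i)); last by move=> i _; rewrite lnK// posrE.
move=> le_ma.
rewrite (eq_bigr (fun i : 'I_n => a i / m i)%R); last first.
  by move=> i _; rewrite /lratio -/(a i) -/(b i) /m invf_div mulrA [(2 * _)%R]mulrC.
by rewrite big_split/= prodfV ler_pdivlMr ?mul1r// prodr_gt0.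
Qed.

End mle_ratio.

(** * Almost sure convergence from countably many balls and compactness *)

Theorem theorem2p3 (R : realType) (p d : nat)
    (mu : {sigma_finite_measure set (Rn R p) -> \bar R})
    (Theta : set (Rn R d)) (f : Rn R p -> Rn R d -> R)
    (dens : density_family mu Theta f)
    (metric : D_KW_is_metric Theta)
    (cpt : compact [set: subdistr Theta])
    (dO : measure_display) (Omega : measurableType dO)
    (P : probability Omega R)
    (Gstar : distr Theta) (X : nat -> Omega -> Rn R p)
    (iid : iid_from P mu X (fun x => mixture f x (subdistr_of Gstar)))
    (identifiable : forall G : distr Theta,
       (forall x, mixture_cdf mu f x (subdistr_of G) =
                  mixture_cdf mu f x (subdistr_of Gstar)) ->
       D_KW (subdistr_of G) (subdistr_of Gstar) = 0)
    (Theta_closed : closedRn Theta)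
    (f_continuous : forall (x : Rn R p) (G0 : subdistr Theta),
       mixture f x G @[G --> G0] --> mixture f x G0)
    (Ghat : nat -> Omega -> distr Theta)
    (mle : forall n, is_NPMLE f X n (Ghat n)) :
  {ae P, forall w,
     D_KW (subdistr_of (Ghat n w)) (subdistr_of Gstar) @[n --> \oo] --> 0}.
Proof.
have mTheta := closedRn_measurable Theta_closed.
have fin := mixture_fin_num dens mTheta metric f_continuous.
pose r x := mixture f x (subdistr_of Gstar).
have mr : measurable_fun setT r by exact: measurable_mixture dens mTheta _.
have r0 x : 0 <= r x by exact: (mixture_ge0 dens).
have [mX _ law] := iid.
(* The zero set of [r] has probability 0 under the law with density [r]. *)
have ae_r : {ae P, forall w, forall i, 0 < r (X i w)}.
  apply: ae_foralln => i; exists (X i @^-1` [set x | r x = 0]).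
  have mr0 : measurable [set x | r x = 0].
    by have := mr measurableT _ (emeasurable_set1 0); rewrite setTI.
  split.
  - by rewrite -[X in measurable X]setTI; exact: mX.
  - by rewrite [LHS]law//; apply: integral0_eq => x.
  - by move=> w /=; rewrite lt_neqAle r0 andbT => /negP; rewrite negbK => /eqP.
have [D Ddense] := D_KW_separable metric cpt (subdistr_of Gstar).
(* Balls with centres [D k] and radii [1 / m.+1] form a countable family, and one [h] is fixed for
   each, so that only countably many null sets are discarded. *)
pose good k (e : R) (h : Rn R p -> R) := [/\ measurable_fun setT h,
  forall x, (0 <= h x <= 2)%R, \int[mu]_x ((h x)%:E * r x) < 1 &
  forall G x, D_KW G (D k) < e%:E -> 0 < r x -> (lratio f Gstar G x <= h x)%R].
have ae_prod : {ae P, forall w, forall k m : nat,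
    (exists h, good k (m.+1%:R^-1)%R h) ->
    exists2 h, good k (m.+1%:R^-1)%R h &
      \forall n \near \oo, (\prod_(i < n) h (X i w) < 1)%R}.
  apply: ae_foralln => k; apply: ae_foralln => m.
  have [[h hgood]|nh] := pselect (exists h, good k (m.+1%:R^-1)%R h); last first.
    by apply: aeW => w /nh.
  have [mh h02 h1 _] := hgood.
  have h03 x : (0 <= h x < 3%:R)%R.
    by have /andP[-> /le_lt_trans->//] := h02 x; rewrite ltr_nat.
  have := iid_prod_lt1 iid mr r0 mh h03 h1.
  by apply: filterS => w hw _; exists h.
apply: filterS2 ae_r ae_prod => w rw prodw.
suff near0 (e : R) : (0 < e)%R ->
    \forall n \near \oo, D_KW (subdistr_of (Ghat n w)) (subdistr_of Gstar) < e%:E.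
  apply/fine_cvgP; split; first by apply: nearW => n; exact: D_KW_fin_num.
  apply/cvgrPdist_lt => e /near0; apply: filterS => n /= ne.
  rewrite sub0r normrN ger0_norm ?fine_ge0 ?D_KW_ge0//.
  by rewrite -lte_fin fineK ?D_KW_fin_num.
(* With [w] fixed, near-covering is applied to the implication from [Ghat n w] being [G] to [G]
   being close to [Gstar]: near [Gstar] its conclusion holds, elsewhere its premise eventually
   fails. *)
move=> e0; have /compact_near_coveringP := cpt.
move=> /(_ nat \oo (fun n G => subdistr_of (Ghat n w) = G ->
  D_KW G (subdistr_of Gstar) < e%:E) _)[].
  move=> G _; have [Gstar0|Gstar0] := eqVneq (D_KW G (subdistr_of Gstar)) 0.
    exists ([set H | D_KW H G < e%:E], setT) => [|[H n] /= [HG _] _].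
      by split; [apply/(D_KW_nbhsP metric); exists e|exact: filterT].
    rewrite (le_lt_trans (D_KW_triangle metric H G (subdistr_of Gstar)))//.
    by rewrite Gstar0 adde0.
  have [c [h [c0 mh h02 h1 hP]]] := lratio_dominated dens mTheta metric cpt
    f_continuous identifiable Gstar0.
  (* A ball of radius below [c / 2] whose centre [D k] is closer to [G] than this radius contains
     [G] and lies within the ball of radius [c] around [G], so it inherits [h]. *)
  have c20 : (0 < c / 2)%R by rewrite divr_gt0.
  have [m _ /(_ m (leqnn m)) /= mc] := near_infty_natSinv_lt (PosNum c20).
  have [|k kG] := Ddense G (m.+1%:R^-1)%R; first by rewrite invr_gt0.
  have [|h' [_ _ _ h'P] h'lt1] := prodw k m.
    exists h; split=> // H x Hk; apply: hP.
    rewrite (le_lt_trans (D_KW_triangle metric H (D k) G))//.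
    rewrite [c]splitr EFinD lteD// (lt_trans _ (_ : (m.+1%:R^-1)%:E < _))//.
  exists ([set H | D_KW H (D k) < (m.+1%:R^-1)%:E],
          [set n | (\prod_(i < n) h' (X i w) < 1)%R]) => /=.
    split=> //; have kG' : D_KW G (D k) < (m.+1%:R^-1)%:E by rewrite (D_KWC metric).
    have [s s0 sP] := D_KW_ball_open metric kG'.
    by apply/(D_KW_nbhsP metric); exists s.
  (* If the estimator were in this ball, its product of ratios, at least 1, would be bounded by the
     product of the [h'], which is below 1. *)
  move=> [H n] /= [Hk nlt1] HE; exfalso; move: nlt1.
  apply/negP; rewrite -leNgt.
  apply: (@le_trans _ _ (\prod_(i < n) lratio f Gstar H (X i w))%R).
    rewrite -HE; apply: (mle_lratio_ge1 dens mTheta fin (x := X ^~ w)) => // H'.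
    have [_ ->] := mle n; apply: ereal_sup_ubound; by exists H'.
  by apply: ler_prod => i _; rewrite (lratio_ge0 dens)/= h'P.
move=> N _ NP; exists N => // n /NP nP; exact: nP.
Qed.
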